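(* For all integers $n\ge 1$, \[ \widetilde{\sigma}(n)=-\sum_{k\ge 1}\widetilde{\sigma}\left(n-\frac{k(k+1)}{2}\right)+n\,\chi_{T}(n), \] where the sum runs over all integers $k\ge 1$ (only finitely many terms are nonzero).
   Context: For an integer $n\ge 1$ let $\sigma_{0}(n)=\sum_{d\mid n,\ d\text{ even}}d$ and $\sigma_{1}(n)=\sum_{d\mid n,\ d\text{ odd}}d$, where the sums run over the positive divisors $d$ of $n$, and let $\widetilde{\sigma}(n)=\sigma_{1}(n)-\sigma_{0}(n)$. For integers $n\le 0$, set $\sigma_0(n)=\sigma_1(n)=0$, so that $\widetilde{\sigma}(n)=0$. A triangular number is an integer of the form $t_k=\frac{k(k+1)}{2}$ with $k\ge 0$ an integer; let $T=\{t_k\mid k\ge 0\}$. The function $\chi_T$ is the characteristic function of $T$: $\chi_T(n)=1$ if $n\in T$ and $\chi_T(n)=0$ if $n\notin T$. *)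

(* Defs.v *)
From mathcomp Require Import all_boot all_order all_algebra.
From mathcomp Require Import boolp classical_sets functions cardinality fsbigop.

Set Implicit Arguments.
Unset Strict Implicit.
Unset Printing Implicit Defensive.

Import GRing.Theory Num.Theory.

Local Open Scope classical_set_scope.
Local Open Scope ring_scope.

(* The guard is needed at 0 and below: [divisors 0] is [[:: 1]], not empty,
   and [`|n|] forgets the sign. *)
Definition sigma0 (n : int) : int :=
  if 0 < n then \sum_(d <- divisors `|n|%N | ~~ odd d) d%:Z else 0.

Definition sigma1 (n : int) : int :=
  if 0 < n then \sum_(d <- divisors `|n|%N | odd d) d%:Z else 0.

Definition sigmat (n : int) : int := sigma1 n - sigma0 n.

Definition triangular (k : nat) : int := ((k * (k + 1)) %/ 2)%N%:Z.

Definition Triangular : set int := range triangular.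

Definition chiT (n : int) : int := if n \in Triangular then 1 else 0.

(* Main.v *)
(* Gauss: the generating function psi of the triangular numbers is
   prod (1 - q^(2i)) / (1 - q^(2i-1)).  Its logarithmic derivative
   q psi' / psi = sum_n sigmat n q^n gives q psi' = psi * sum_n sigmat n q^n,
   whose n-th coefficient is the claim.  Power series are avoided by Shanks'
   finite form of Gauss' identity, with denominators cleared,
     (sum_(s < 2n) q^(s(s+1)/2)) * prod_(i < n) (1 - q^(2i+1))
     = sum_(s < n) prod_(i < s) (1 - q^(2i+1))
                   * prod_(s <= i < n) (1 - q^(2i+2)) * q^(s(2n+1)),
   whose right-hand side is prod_(i < n) (1 - q^(2i+2)) up to O(q^(2n+1)). *)
Require Import Defs.
From mathcomp Require Import all_boot all_order all_algebra.
From mathcomp Require Import boolp classical_sets functions cardinality fsbigop.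
From mathcomp Require Import zify ring.

Set Implicit Arguments.
Unset Strict Implicit.
Unset Printing Implicit Defensive.

Import Order.TTheory GRing.Theory Num.Theory.

Local Open Scope classical_set_scope.
Local Open Scope ring_scope.

(** * Shanks' finite form of Gauss' identity *)

Section Shanks.
Variables (R : comNzRingType) (q : R).

Definition odd_prod n : R := \prod_(i < n) (1 - q ^+ (2 * i + 1)).
Definition even_prod s n : R := \prod_(s <= i < n) (1 - q ^+ (2 * i + 2)).

Definition shanks_sum n : R :=
  \sum_(s < n) odd_prod s * even_prod s n * q ^+ (s * (2 * n + 1)).

Lemma bin2SD n : 'C(n.+1, 2) = (n + 'C(n, 2))%N.
Proof. by rewrite binS bin1 addnC. Qed.

Lemma bin2_odd n : 'C((2 * n).+1, 2) = (n * (2 * n + 1))%N.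
Proof. by rewrite bin2 -[RHS]doubleK; congr _./2; rewrite -muln2; nia. Qed.

(* The summand is the s-th term of
   shanks_sum n.+1 - (1 - q ^+ (2 * n + 1)) * shanks_sum n. *)
Lemma shanks_telescope n k : (k <= n)%N ->
  \sum_(s < k) odd_prod s * even_prod s n *
     ((1 - q ^+ (2 * n + 2)) * q ^+ (s * (2 * n + 3))
      - (1 - q ^+ (2 * n + 1)) * q ^+ (s * (2 * n + 1)))
  = odd_prod k * even_prod k n * (1 - q ^+ (2 * k)) * q ^+ (k * (2 * n + 1)).
Proof.
elim: k => [|k IH] lekn.
  by rewrite big_ord0 muln0 expr0 subrr mulr0 mul0r.
rewrite big_ord_recr /= IH 1?ltnW //.
rewrite [odd_prod k.+1]/odd_prod big_ord_recr /= -/(odd_prod k).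
rewrite [even_prod k n]/even_prod big_ltn // -/(even_prod k.+1 n).
have -> : (k * (2 * n + 3) = k * (2 * n + 1) + 2 * k)%N by lia.
have -> : (k.+1 * (2 * n + 1) = k * (2 * n + 1) + (2 * n + 1))%N by lia.
have -> : (2 * k.+1 = 2 * k + 2)%N by lia.
have -> : (2 * n + 2 = 2 * n + 1 + 1)%N by lia.
rewrite !exprD; ring.
Qed.

(** Induction on [n]: passing to [n.+1] adds the exponents [n(2n+1)] and [(n+1)(2n+1)] on the left,
    and [shanks_telescope] at [k = n] together with the new term [s = n] accounts for them on the
    right. *)
Lemma shanks n :
  (\sum_(s < 2 * n) q ^+ 'C(s.+1, 2)) * odd_prod n = shanks_sum n.
Proof.
elim: n => [|n IH]; first by rewrite muln0 /shanks_sum !big_ord0 mul0r.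
have -> : shanks_sum n.+1 = (1 - q ^+ (2 * n + 1)) * shanks_sum n
    + odd_prod n * (1 - q ^+ (2 * n)) * q ^+ (n * (2 * n + 1))
    + odd_prod n * (1 - q ^+ (2 * n + 2)) * q ^+ (n * (2 * n + 3)).
  have := shanks_telescope (leqnn n).
  rewrite [even_prod n n]/even_prod big_geq // mulr1 => <-.
  rewrite /shanks_sum big_ord_recr /= mulr_sumr -big_split /=; congr (_ + _).
    apply: eq_bigr => s _; rewrite /even_prod big_nat_recr /= 1?ltnW ?ltn_ord //.
    have -> : (2 * n.+1 + 1 = 2 * n + 3)%N by lia.
    ring.
  rewrite /even_prod big_nat1; have -> : (2 * n.+1 + 1 = 2 * n + 3)%N by lia.
  by [].
rewrite -IH mulnS 2!big_ord_recr /=.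
rewrite [odd_prod n.+1]/odd_prod big_ord_recr /= -/(odd_prod n).
have -> : 'C((2 * n).+2, 2) = (n * (2 * n + 1) + (2 * n + 1))%N.
  by rewrite bin2SD bin2_odd; lia.
rewrite bin2_odd.
have -> : (n * (2 * n + 3) = n * (2 * n + 1) + 2 * n)%N by lia.
have -> : (2 * n + 2 = 2 * n + 1 + 1)%N by lia.
rewrite !exprD; ring.
Qed.

(** In [shanks_sum n.+1] the term [s = 0] is the even product, and each later term carries
    [q ^+ (s * (2 * n + 3))]. *)
Lemma gauss_trunc n : exists r,
  (\sum_(s < 2 * n.+1) q ^+ 'C(s.+1, 2)) * odd_prod n.+1
  = even_prod 0 n.+1 + q ^+ (2 * n + 3) * r.
Proof.
exists (\sum_(s < n) odd_prod s.+1 * even_prod s.+1 n.+1 * q ^+ (s * (2 * n + 3))).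
rewrite shanks /shanks_sum big_ord_recl /= {1}/odd_prod big_ord0 mul0n mul1r mulr1.
congr (_ + _); rewrite mulr_sumr; apply: eq_bigr => s _; rewrite /bump /= add1n.
have -> : (s.+1 * (2 * n.+1 + 1) = (2 * n + 3) + s * (2 * n + 3))%N by lia.
by rewrite exprD; ring.
Qed.

Lemma prod_odd_exponents n :
  \prod_(1 <= d < (2 * n).+1 | odd d) (1 - q ^+ d) = odd_prod n.
Proof.
elim: n => [|n IH]; first by rewrite big_geq // /odd_prod big_ord0.
rewrite mulnS !big_mkcond /= 2?big_nat_recr //= -big_mkcond /= IH.
by rewrite oddM /= mulr1 /odd_prod big_ord_recr /= addn1.
Qed.

Lemma prod_even_exponents n :
  \prod_(1 <= d < (2 * n).+1 | ~~ odd d) (1 - q ^+ d) = even_prod 0 n.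
Proof.
elim: n => [|n IH]; first by rewrite big_geq // /even_prod big_geq.
rewrite mulnS !big_mkcond /= 2?big_nat_recr //= -big_mkcond /= IH.
by rewrite oddM /= mulr1 /even_prod big_nat_recr //= addn2.
Qed.

End Shanks.

(** * Logarithmic derivatives modulo powers of ['X] *)

(* [lambert m d] is [d * 'X^d / (1 - 'X^d)] up to terms of degree above [m]. *)
Definition lambert m d : {poly rat} := \sum_(i < m) d%:R *: 'X^(d * i.+1).

Lemma lambertM m d :
  lambert m d * (1 - 'X^d) = d%:R *: 'X^d - d%:R *: 'X^(d * m.+1).
Proof.
rewrite /lambert; elim: m => [|m IH]; first by rewrite big_ord0 mul0r muln1 subrr.
rewrite big_ord_recr /= mulrDl IH (mulnS d m.+1) exprD.
rewrite -!mul_polyC; ring.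
Qed.

Lemma coef_lambert m d j : (0 < d)%N -> (j <= m)%N ->
  (lambert m d)`_j = if (0 < j)%N && (d %| j)%N then d%:R else 0.
Proof.
move=> d0 jm; rewrite coef_sum.
under eq_bigr do rewrite coefZ coefXn.
case: ifPn => [/andP[j0 /dvdnP[k jE]]|nj].
  have k0 : (0 < k)%N by move: j0; rewrite jE muln_gt0 => /andP[].
  have km : (k.-1 < m)%N by rewrite prednK // (leq_trans _ jm) // jE leq_pmulr.
  rewrite (bigD1 (Ordinal km)) //= big1 ?addr0 => [|i /eqP ik].
    by rewrite prednK // mulnC -jE eqxx mulr1.
  case: eqP => [jE'|]; rewrite ?mulr1 ?mulr0 //.
  case: ik; apply: val_inj => /=.
  have : (d * i.+1 = d * k)%N by lia.
  by move/eqP; rewrite eqn_pmul2l // => /eqP <-.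
apply: big1 => i _; case: eqP => [jE|]; rewrite ?mulr0 //.
by case/negP: nj; rewrite jE muln_gt0 d0 dvdn_mulr.
Qed.

(** By [lambertM], one factor contributes [-d 'X^d], which is [-(1 - 'X^d) * lambert m d] modulo
    ['X^(d * m.+1)]; the Leibniz rule adds these contributions. *)
Lemma log_deriv_prod m (r : seq nat) (P : pred nat) :
  {in r, forall d, 0 < d}%N ->
  'X^(m.+1) %| 'X * (\prod_(d <- r | P d) (1 - 'X^d))^`()
     + (\prod_(d <- r | P d) (1 - 'X^d)) * \sum_(d <- r | P d) lambert m d.
Proof.
elim: r => [|d r IH] r0.
  by rewrite !big_nil mulr0 addr0 -polyC1 derivC mulr0 dvdp0.
have {}IH := IH (fun e er => r0 e (mem_behead (s := d :: r) er)).
rewrite !big_cons; case: ifP => // _.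
set p := \prod_(_ <- _ | _) _ in IH *; set s := \sum_(_ <- _ | _) _ in IH *.
have d0 : (0 < d)%N by apply: r0; rewrite mem_head.
have -> : 'X * ((1 - 'X^d) * p)^`() + (1 - 'X^d) * p * (lambert m d + s)
   = (1 - 'X^d) * ('X * p^`() + p * s) - p * (d%:R *: 'X^(d * m.+1)) :> {poly rat}.
  have dX : 'X * ('X^d)^`() = d%:R *: 'X^d :> {poly rat}.
    by rewrite derivXn -scaler_nat -scalerAr -exprS prednK.
  have -> : 'X * ((1 - 'X^d) * p)^`() = (1 - 'X^d) * ('X * p^`()) - p * ('X * ('X^d)^`()).
    by rewrite derivM derivB -polyC1 derivC polyC1; ring.
  have -> : (1 - 'X^d) * p * (lambert m d + s)
    = p * (lambert m d * (1 - 'X^d)) + (1 - 'X^d) * p * s by ring.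
  by rewrite dX lambertM; ring.
apply: dvdp_sub; apply: dvdp_mull => //.
by rewrite -mul_polyC dvdp_mull // dvdp_exp2l // leq_pmull.
Qed.

(** Truncated Lambert series generating [sigma1] and [sigma0]. *)
Definition lambert_odd m n := \sum_(1 <= d < (2 * n).+1 | odd d) lambert m d.
Definition lambert_even m n := \sum_(1 <= d < (2 * n).+1 | ~~ odd d) lambert m d.

Definition tri_poly n : {poly rat} := \sum_(s < 2 * n) 'X^('C(s.+1, 2)).

Lemma tri_log_deriv n :
  'X^(n.+2) %| 'X * (tri_poly n.+1)^`()
     - tri_poly n.+1 * (lambert_odd n.+1 n.+1 - lambert_even n.+1 n.+1).
Proof.
have [r rE] := gauss_trunc ('X : {poly rat}) n; rewrite -/(tri_poly n.+1) in rE.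
have pos d : d \in index_iota 1 (2 * n.+1).+1 -> (0 < d)%N.
  by rewrite mem_index_iota => /andP[].
have ho := @log_deriv_prod n.+1 _ odd pos.
have he := @log_deriv_prod n.+1 _ (predC odd) pos.
rewrite /= prod_odd_exponents -/(lambert_odd _ _) in ho.
rewrite /= prod_even_exponents -/(lambert_even _ _) in he.
move: ho he rE; set Q := odd_prod _ _; set N := even_prod _ _ _.
set T := tri_poly _; set So := lambert_odd _ _; set Se := lambert_even _ _.
move=> ho he rE.
(* [Q] has constant term 1, so it can be cancelled modulo a power of ['X]; this replaces division of
   series. *)
have cop : coprimep 'X^(n.+2) Q.
  rewrite coprimep_expl // coprimep_sym coprimepX /root.
  rewrite /Q /odd_prod horner_prod prodf_seq_neq0; apply/allP => i _ /=.
  by rewrite !hornerE expr0n addn1 subr0 oner_neq0.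
rewrite -(Gauss_dvdpr _ cop).
have drE : T^`() * Q + T * Q^`() = N^`() + ('X^(2 * n + 3))^`() * r + 'X^(2 * n + 3) * r^`().
  by rewrite -derivM rE derivD derivM addrA.
have -> : Q * ('X * T^`() - T * (So - Se)) = ('X * N^`() + N * Se)
   + 'X * (('X^(2 * n + 3))^`() * r) + 'X^(2 * n + 3) * ('X * r^`() + r * Se)
   - T * ('X * Q^`() + Q * So).
  (* The two sides differ by a combination of [rE] and its derivative [drE]. *)
  apply/eqP; rewrite -subr_eq0; apply/eqP.
  transitivity ('X * ((T^`() * Q + T * Q^`())
       - (N^`() + ('X^(2 * n + 3))^`() * r + 'X^(2 * n + 3) * r^`()))
     + Se * (T * Q - (N + 'X^(2 * n + 3) * r))); first by ring.
  by rewrite drE rE !subrr !mulr0 addr0.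
have le1 : (n.+2 <= 2 * n + 3)%N by lia.
apply: dvdp_sub; last exact: dvdp_mull.
apply: dvdp_add; last by rewrite dvdp_mulr // dvdp_exp2l.
apply: dvdp_add => //; rewrite derivXn mulrA dvdp_mulr //.
by rewrite addn3 /= -mulr_natr mulrA -exprS dvdp_mulr // dvdp_exp2l //; lia.
Qed.

(** * Coefficients and the recurrence *)

Lemma sum_divisors (V : nmodType) (F : nat -> V) (P : pred nat) j m :
  (0 < j <= m)%N ->
  \sum_(d <- divisors j | P d) F d
  = \sum_(1 <= d < m.+1 | P d) if (d %| j)%N then F d else 0.
Proof.
case/andP=> j0 jm; rewrite -big_mkcondr /= big_andbC -big_filter_cond.
apply: perm_big; apply: uniq_perm; rewrite ?filter_uniq ?divisors_uniq ?iota_uniq //.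
move=> d; rewrite !mem_filter mem_index_iota -dvdn_divisors // ltnS.
case: (boolP (d %| j)%N) => //= dj; rewrite ?andbF //.
by rewrite (dvdn_gt0 j0 dj) (leq_trans (dvdn_leq j0 dj) jm) !andbT.
Qed.

Lemma coef_lambert_sum (P : pred nat) m j : (j <= m.+1)%N ->
  (\sum_(1 <= d < (2 * m.+1).+1 | P d) lambert m.+1 d)`_j
  = (if 0 < j%:Z then \sum_(d <- divisors j | P d) d%:Z else 0)%:~R.
Proof.
move=> jm; rewrite coef_sum.
have -> : \sum_(1 <= d < (2 * m.+1).+1 | P d) (lambert m.+1 d)`_j
  = \sum_(1 <= d < (2 * m.+1).+1 | P d) if (0 < j)%N && (d %| j)%N then d%:R else 0.
  rewrite big_nat_cond [RHS]big_nat_cond; apply: eq_bigr => d /andP[/andP[d0 _] _].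
  by rewrite coef_lambert.
rewrite ltz_nat; case: posnP => [_|j0] /=; first by rewrite big1.
rewrite (@sum_divisors _ _ _ _ (2 * m.+1)); last by rewrite j0; lia.
by rewrite rmorph_sum /=; apply: eq_bigr => d _; case: ifP.
Qed.

Lemma coef_sigmat m j : (j <= m.+1)%N ->
  (lambert_odd m.+1 m.+1 - lambert_even m.+1 m.+1)`_j = (sigmat j)%:~R.
Proof. by move=> jm; rewrite coefB !coef_lambert_sum // -rmorphB. Qed.

Lemma triangularE k : triangular k = 'C(k.+1, 2)%:Z.
Proof. by rewrite /triangular bin2 divn2 addn1 mulnC. Qed.

Lemma triangular_bin_lt a b : (a < b)%N -> ('C(a.+1, 2) < 'C(b.+1, 2))%N.
Proof.
move=> ab; rewrite (bin2SD b) -[X in (X < _)%N]add0n.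
by rewrite (leq_trans _ (leq_add (leq_ltn_trans (leq0n a) ab) (leq_bin2l 2 ab))).
Qed.

Lemma leq_triangular_bin k : (k <= 'C(k.+1, 2))%N.
Proof. by rewrite bin2SD leq_addr. Qed.

(** Triangular numbers increase strictly, so no exponent repeats; since the [k]-th is at least [k],
    those below [2 * n] all occur in the truncated sum. *)
Lemma coef_tri_poly n j : (j < 2 * n)%N -> (tri_poly n)`_j = (chiT j)%:~R.
Proof.
move=> jn; rewrite /tri_poly coef_sum; under eq_bigr do rewrite coefXn.
rewrite /chiT; case: ifPn => [/set_mem [k _ kE]|/negP nT].
  have jE : j = 'C(k.+1, 2) by move: kE; rewrite triangularE => -[].
  have kn : (k < 2 * n)%N by rewrite (leq_ltn_trans _ jn) // jE leq_triangular_bin.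
  rewrite (bigD1 (Ordinal kn)) //= big1 -?jE ?eqxx ?addr0 // => i /eqP ik.
  rewrite jE; case: (ltngtP k i) => [/triangular_bin_lt|/triangular_bin_lt|ki].
  - by rewrite ltn_neqAle => /andP[/negPf ->].
  - by rewrite ltn_neqAle eq_sym => /andP[/negPf ->].
  - by case: ik; apply: val_inj.
apply: big1 => i _; case: eqP => // jE; case: nT; apply/mem_set.
by exists (val i) => //; rewrite triangularE jE.
Qed.

Lemma sigmat_le0 (n : int) : n <= 0 -> sigmat n = 0.
Proof. by move=> n0; rewrite /sigmat /sigma1 /sigma0 ltNge n0 subrr. Qed.


(** This compares coefficients of degree [n.+1] in [tri_log_deriv]. The index [k = 0] is kept: its
    term is [sigmat n.+1] itself. *)
Lemma sum_sigmat n :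
  \sum_(0 <= k < 2 * n.+1) sigmat (n.+1%:Z - triangular k) = n.+1%:Z * chiT n.+1.
Proof.
apply: (@intr_inj rat); rewrite rmorph_sum big_mkord /=.
have /dvdpP[r] := tri_log_deriv n.
move=> /(congr1 (fun p : {poly rat} => p`_n.+1)) /=.
rewrite coefMXn ltnSn coefB coefXM coef_deriv /= coef_tri_poly; last by lia.
move/eqP; rewrite subr_eq0 intrM -[n.+1%:~R]/(n.+1%:R) mulr_natl => /eqP ->.
rewrite /tri_poly mulr_suml coef_sum; apply: eq_bigr => s _.
(* A triangular number above [n.+1] gives coefficient 0, matching the value of [sigmat] at negative
   arguments. *)
rewrite coefXnM triangularE; case: ltnP => lt.
  by rewrite sigmat_le0 //; lia.
by rewrite coef_sigmat ?leq_subr // subzn.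
Qed.

Unset Implicit Arguments.

(* [\sum_(k \in A)] is the sum over the support of the summand in A, and is 0
   by convention if that support is infinite; hence the finiteness clause. *)
Theorem theorem2p2 (n : int) (hn : 1 <= n) :
  finite_set [set k : nat | (1 <= k)%N /\ sigmat (n - triangular k) <> 0] /\
  sigmat n =
    - (\sum_(k \in [set k : nat | (1 <= k)%N]) sigmat (n - triangular k))
    + n * chiT n.
Proof.
case: n hn => // -[//|n] _.
(* This bound gives both the finiteness of the support and the reduction to a finite sum. *)
have large k : (2 * n.+1 <= k)%N -> sigmat (n.+1%:Z - triangular k) = 0.
  move=> nk; apply: sigmat_le0; rewrite triangularE.
  by have := leq_triangular_bin k; lia.
split.
  apply: sub_finite_set (finite_II (2 * n.+1)) => k [_ sk] /=.
  by rewrite ltnNge; apply/negP => /large.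
rewrite -(@fsbig_widen _ _ _ _ [set` index_iota 1 (2 * n.+1)]); first last.
- move=> k [/= k0]; rewrite mem_index_iota k0 /= => /negP; rewrite -leqNgt.
  exact: large.
- by move=> k /=; rewrite mem_index_iota => /andP[].
(* Splitting off [k = 0] isolates [sigmat n.+1]. *)
rewrite -fsbig_seq ?iota_uniq // -sum_sigmat (big_ltn (m := 0)) //.
by rewrite addrC addrK triangularE subr0.
Qed.
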